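(* Let $\mathcal{M}$ be a reversible Markov chain on a state space $\Sigma$ with stationary distribution $\pi$ and label function $\omega:\Sigma\to\mathbb{R}$. Let $k\ge 0$ and $m\ge 1$ be integers, let $\varepsilon>0$, $\alpha>0$ and $r$ be real numbers, and let $\sigma_0\in\Sigma$ be a fixed state. Consider $m$ independent trajectories $$\mathcal{T}^1=(X^1_0,X^1_1,\dots,X^1_k),\quad\dots,\quad \mathcal{T}^m=(X^m_0,X^m_1,\dots,X^m_k)$$ of $\mathcal{M}$ from the common starting point $X^1_0=\dots=X^m_0=\sigma_0$. Let $\rho$ be the number of indices $i\in\{1,\dots,m\}$ such that $\omega(\sigma_0)$ is an $\varepsilon$-outlier among $\omega(X^i_0),\omega(X^i_1),\dots,\omega(X^i_k)$. If $\sigma_0$ is not an $(\varepsilon,\alpha)$-outlier in $\mathcal{M}$ with respect to $k$, then $$\Pr\left(\rho\ge m\sqrt{\tfrac{2\varepsilon}{\alpha}}+r\right)\le \exp\left(-\min\left(\frac{r^2\sqrt{\alpha/(2\varepsilon)}}{3m},\ \frac{r}{3}\right)\right).$$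
   Context: Markov chains are time-homogeneous, discrete-time, on a discrete (finite or countable) state space $\Sigma$, specified by transition probabilities $P(\sigma,\tau)$. A trajectory of $\mathcal{M}$ from $\sigma_0$ is a sequence $X_0=\sigma_0,X_1,X_2,\dots$ of random variables with $\Pr(X_i=\sigma_i\mid X_{i-1}=\sigma_{i-1},\dots,X_0=\sigma_0)=P(\sigma_{i-1},\sigma_i)$. A trajectory is $\pi$-stationary if $X_0\sim\pi$, where $\pi$ is a stationary distribution. $\mathcal{M}$ is reversible (with respect to $\pi$) if every $\pi$-stationary trajectory $X_0,\dots,X_k$ has the same distribution as its reverse $X_k,\dots,X_0$. A real number $a_0$ is an $\varepsilon$-outlier among $a_0,\dots,a_k$ if $\#\{i\in\{0,\dots,k\}: a_i\le a_0\}\le \varepsilon(k+1)$. For $\sigma\in\Sigma$, let $p^k_{0,\varepsilon}(\sigma)$ be the probability that, on a trajectory $\sigma=X_0,X_1,\dots,X_k$ of $\mathcal{M}$ started at $\sigma$, $\omega(\sigma)$ is an $\varepsilon$-outlier among $\omega(X_0),\dots,\omega(X_k)$. With respect to $k$, the state $\sigma_0$ is an $(\varepsilon,\alpha)$-outlier in $\mathcal{M}$ if $p^k_{0,\varepsilon}(\sigma_0)$ is in the largest $\alpha$ fraction of the values $p^k_{0,\varepsilon}(\sigma)$ over all states $\sigma\in\Sigma$, weighted according to $\pi$; that is, if $\Pr_{\sigma\sim\pi}\big(p^k_{0,\varepsilon}(\sigma)\ge p^k_{0,\varepsilon}(\sigma_0)\big)\le\alpha$. *)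

(* Defs.v *)
From mathcomp Require Import all_boot all_order all_algebra.
From mathcomp Require Import all_classical all_reals all_analysis.

Set Implicit Arguments.
Unset Strict Implicit.
Unset Printing Implicit Defensive.

Import Order.TTheory GRing.Theory Num.Theory.

Local Open Scope classical_set_scope.
Local Open Scope ring_scope.

(* A [countType] is a finite or countably infinite type; it is given the
   discrete sigma-algebra. *)
Record markov_chain (R : realType) (S : countType) := MarkovChain {
  trans :> S -> S -> R ;
  trans_ge0 : forall x y, 0 <= trans x y ;
  trans_sum1 : forall x, (\esum_(y in [set: S]) (trans x y)%:E = 1)%E
}.

Definition stationary_distribution (R : realType) (S : countType)
    (M : markov_chain R S) (mu : S -> R) : Prop :=
  [/\ forall x, 0 <= mu x,
      (\esum_(x in [set: S]) (mu x)%:E = 1)%E &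
      forall y, (\esum_(x in [set: S]) (mu x * M x y)%:E = (mu y)%:E)%E].

Definition discrete_random_variable d (T : measurableType d) (S : countType)
    (X : T -> S) : Prop :=
  forall A : set S, measurable (X @^-1` A).

(* Equals 0 when [P B = 0]; only used for [P B != 0]. *)
Definition cond_prob d (T : measurableType d) (R : realType)
    (P : probability T R) (A B : set T) : R :=
  fine (P (A `&` B)) / fine (P B).

(* For [i : 'I_k], [widen_ord (leqnSn k) i] and [lift ord0 i] are the times
   [i] and [i + 1] of ['I_k.+1] = {0, ..., k}. *)
Definition trajectory (R : realType) (S : countType) (M : markov_chain R S)
    d (T : measurableType d) (P : probability T R) (k : nat)
    (X : 'I_k.+1 -> T -> S) : Prop :=
  (forall j, discrete_random_variable (X j)) /\
  forall (s : 'I_k.+1 -> S) (i : 'I_k),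
    let cur := widen_ord (leqnSn k) i in
    let next := lift ord0 i in
    let past := [set t | forall j : 'I_k.+1, (j <= i)%N -> X j t = s j] in
    P past != 0%E ->
    cond_prob P [set t | X next t = s next] past = M (s cur) (s next).

Definition trajectory_from (R : realType) (S : countType)
    (M : markov_chain R S) d (T : measurableType d) (P : probability T R)
    (k : nat) (x0 : S) (X : 'I_k.+1 -> T -> S) : Prop :=
  trajectory M P X /\ P [set t | X ord0 t = x0] = 1%E.

Definition stationary_trajectory (R : realType) (S : countType)
    (M : markov_chain R S) (mu : S -> R) d (T : measurableType d)
    (P : probability T R) (k : nat) (X : 'I_k.+1 -> T -> S) : Prop :=
  trajectory M P X /\ forall x, P [set t | X ord0 t = x] = (mu x)%:E.

Definition reversible (R : realType) (S : countType) (M : markov_chain R S)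
    (mu : S -> R) : Prop :=
  forall (d : measure_display) (T : measurableType d) (P : probability T R)
    (k : nat) (X : 'I_k.+1 -> T -> S),
  stationary_trajectory M mu P X ->
  forall A : set ('I_k.+1 -> S),
    P [set t | A (fun j => X j t)] = P [set t | A (fun j => X (rev_ord j) t)].

(* Mutual independence of m random paths; taking some [A i] to be [setT]
   gives the product rule for every subfamily. *)
Definition independent_paths d (T : measurableType d) (R : realType)
    (P : probability T R) (S : countType) (k m : nat)
    (X : 'I_m -> 'I_k.+1 -> T -> S) : Prop :=
  forall A : 'I_m -> set ('I_k.+1 -> S),
    P [set t | forall i, A i (fun j => X i j t)] =
    (\prod_(i < m) P [set t | A i (fun j => X i j t)])%E.

(* [a ord0] is an [eps]-outlier among [a 0, ..., a k]. *)
Definition eps_outlier (R : realType) (eps : R) (k : nat)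
    (a : 'I_k.+1 -> R) : bool :=
  #|[set i : 'I_k.+1 | a i <= a ord0]%SET|%:R <= eps * k.+1%:R.

(* The law of a trajectory started at [x] is determined by [M] and [x], and
   such trajectories exist, so exactly one [p] belongs to the set below; the
   default value [0] is never used. *)
Definition outlier_prob (R : realType) (S : countType) (M : markov_chain R S)
    (omega : S -> R) (k : nat) (eps : R) (x : S) : R :=
  xget 0 [set p : R |
    forall (d : measure_display) (T : measurableType d) (P : probability T R)
      (X : 'I_k.+1 -> T -> S),
    trajectory_from M P x X ->
    P [set t | eps_outlier eps (fun j => omega (X j t))] = p%:E].

Definition eps_alpha_outlier (R : realType) (S : countType)
    (M : markov_chain R S) (mu : S -> R) (omega : S -> R) (k : nat)
    (eps alpha : R) (x0 : S) : Prop :=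
  (\esum_(x in [set x | (outlier_prob M omega k eps x0 <=
                         outlier_prob M omega k eps x)%R]) (mu x)%:E
   <= alpha%:E)%E.

(* Main.v *)
From HB Require Import structures.
Require Import Defs.
From mathcomp Require Import all_boot all_order all_algebra.
From mathcomp Require Import all_classical all_reals all_analysis.
From mathcomp Require Import zify lra ring.

Set Implicit Arguments.
Unset Strict Implicit.
Unset Printing Implicit Defensive.

Import Order.TTheory GRing.Theory Num.Theory.

Local Open Scope classical_set_scope.
Local Open Scope ring_scope.

(* Let p(x) be the probability that the start of a trajectory from x is an
   eps-outlier.  Glue two independent length-i and length-(k - i) trajectories
   started at x ~ mu, the first one reversed: by detailed balance this is a
   stationary trajectory Z_0, ..., Z_k with Z_i = x.  If x is among the
   eps(k+1) lowest labels of each half, then Z_i is among the 2 eps(k+1) lowest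
   labels of the whole path, which at most 2 eps(k+1) of the k+1 times i can
   satisfy.  Since a shorter half only makes the event more likely, summing
   over i gives E_mu[p^2] <= 2 eps.  If sigma0 is not an (eps, alpha)-outlier,
   Markov's inequality for p^2 yields p(sigma0) <= sqrt(2 eps / alpha), and the
   bound is then the Chernoff bound for m independent Bernoulli events. *)

(** * Sums of nonnegative families and laws of countably valued variables *)

Section esum_complements.
Context {R : realType}.
Local Open Scope ereal_scope.

Lemma esumZl (T : choiceType) (I : set T) (c : R) (a : T -> \bar R) :
  (0 <= c)%R -> (forall i, 0 <= a i) ->
  \esum_(i in I) (c%:E * a i) = c%:E * \esum_(i in I) a i.
Proof.
move=> c0 a0; rewrite /esum -ereal_supZl//; last first.
  apply/set0P; exists (\sum_(x \in set0) a x).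
  by exists set0 => //; exact: fsets_set0.
rewrite image_comp; congr ereal_sup; apply: eq_imagel => A _ /=.
by rewrite ge0_mule_fsumr.
Qed.

Lemma subset_esum (T : choiceType) (I J : set T) (a : T -> \bar R) :
  I `<=` J -> (forall i, 0 <= a i) ->
  \esum_(i in I) a i <= \esum_(i in J) a i.
Proof.
move=> IJ a0; rewrite (esumID I J) ?(setIidr IJ)// leeDl// esum_ge0//.
Qed.

Lemma esum_setX (T1 T2 : choiceType) (I : set T1) (J : set T2)
    (a : T1 -> T2 -> \bar R) : (forall i j, 0 <= a i j) ->
  \esum_(i in I) \esum_(j in J) a i j = \esum_(k in I `*` J) a k.1 k.2.
Proof. by move=> a0; rewrite esum_esum// -setXR. Qed.

Lemma esumM (T1 T2 : choiceType) (I : set T1) (J : set T2)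
    (a : T1 -> R) (b : T2 -> R) :
  (forall i, 0 <= a i)%R -> (forall j, 0 <= b j)%R ->
  \esum_(j in J) (b j)%:E \is a fin_num ->
  \esum_(i in I) \esum_(j in J) (a i * b j)%:E =
  (\esum_(i in I) (a i)%:E) * (\esum_(j in J) (b j)%:E).
Proof.
move=> a0 b0 bfin; rewrite muleC -(fineK bfin) -esumZl//; last first.
  by rewrite fine_ge0// esum_ge0// => j _; rewrite lee_fin.
by apply: eq_esum => i _; rewrite fineK// muleC -esumZl.
Qed.

Lemma esum_finType (T : finType) (A : pred T) (a : T -> \bar R) :
  (forall i, 0 <= a i) -> \esum_(i in [set i | A i]) a i = \sum_(i | A i) a i.
Proof.
move=> a0; rewrite esum_fset//; last exact: finite_finset.
rewrite -(bigfs _ (enum_uniq T))/= ?big_enum_cond//=.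
by move=> i _; rewrite mem_enum.
Qed.

Lemma esum_eq1_inhabited (T : choiceType) (a : T -> \bar R) :
  \esum_(i in [set: T]) a i = 1 -> inhabited T.
Proof.
move=> a1; apply: contrapT => noT; move: a1; rewrite (_ : [set: T] = set0).
  by rewrite esum_set0 => /eqP; rewrite eq_sym onee_eq0.
by apply/seteqP; split => // x _; case: noT.
Qed.

Lemma esum_ind (T : choiceType) (I : set T) (b : T -> bool) (a : T -> R) :
  \esum_(i in I `&` [set i | b i]) (a i)%:E =
  \esum_(i in I) (a i * (b i)%:R)%:E.
Proof.
rewrite esum_mkcondr; apply: eq_esum => i _.
have -> : (i \in [set i | b i]) = b i by apply/idP/idP; rewrite inE.
by case: (b i); rewrite ?mulr1 ?mulr0.
Qed.

(** Countable additivity over the fibres of [Y]; naming each fibre by its [pickle] code turns the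
    union into one indexed by [nat]. *)
Lemma probability_preimage_esum d (T : measurableType d) (P : probability T R)
    (U : countType) (Y : T -> U) (A : set U) :
  Defs.discrete_random_variable Y ->
  P (Y @^-1` A) = \esum_(u in A) P [set t | Y t = u].
Proof.
move=> mY.
transitivity (\esum_(n in pickle @` A) P [set t | pickle (Y t) = n]); last first.
  rewrite esum_image; last by move=> u v _ _; apply: (pcan_inj pickleK).
  apply: eq_esum => u _; congr (P _); apply/seteqP.
  by split=> t /= => [/(pcan_inj pickleK)|->].
have -> : Y @^-1` A = \bigcup_(n in pickle @` A) [set t | pickle (Y t) = n].
  apply/seteqP; split => t /=.
    by move=> At; exists (pickle (Y t)) => //; exists (Y t).
  by move=> [_ [u Au <-] /= /(pcan_inj pickleK)] ->.
rewrite measure_bigcup//; first last.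
- apply/trivIsetP => m n _ _ mn; apply/seteqP; split => // t [/= ->] /eqP.
  by rewrite (negbTE mn).
- by move=> n _; apply: (mY [set u | pickle u = n]).
by rewrite nneseries_esum// set_mem_set.
Qed.

End esum_complements.

(** * Weights of finite paths *)

Section path_weights.
Context {R : realType} {S : countType} (M : markov_chain R S).

(** The probability that the chain at [x] goes on to visit the states of [s] in order. The start
    stays outside the list, so the size of [s] is the number of steps. *)
Fixpoint path_weight (x : S) (s : seq S) : R :=
  if s is y :: s' then M x y * path_weight y s' else 1.

Lemma path_weight_ge0 x s : 0 <= path_weight x s.
Proof. by elim: s x => //= y s IH x; rewrite mulr_ge0// trans_ge0. Qed.

Lemma path_weight_cat x s1 s2 :
  path_weight x (s1 ++ s2) = path_weight x s1 * path_weight (last x s1) s2.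
Proof. by elim: s1 x => [|y s1 IH] x /=; rewrite ?mul1r// IH mulrA. Qed.

Lemma path_weight_rcons x s y :
  path_weight x (rcons s y) = path_weight x s * M (last x s) y.
Proof. by rewrite -cats1 path_weight_cat /= mulr1. Qed.

Lemma last_take (x : S) i s : (i <= size s)%N -> last x (take i s) = nth x (x :: s) i.
Proof. by case: i => [|n] ns; rewrite ?take0// (take_nth x)// last_rcons. Qed.

Definition paths_of_length (n : nat) : set (seq S) := [set s | size s = n].

Lemma esum_path_cons n (F : seq S -> \bar R) : (forall s, (0 <= F s)%E) ->
  (\esum_(s in paths_of_length n.+1) F s =
   \esum_(y in [set: S]) \esum_(s in paths_of_length n) F (y :: s))%E.
Proof.
move=> F0; rewrite esum_setX//.
apply: (@reindex_esum R _ _ _ _ (fun ys : S * seq S => ys.1 :: ys.2)); split.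
- by move=> [y s] [_ /= sn]; rewrite /paths_of_length /= sn.
- by move=> [y s] [y' s'] _ _ /= [-> ->].
- by move=> [|y s]//= [sn]; exists (y, s).
Qed.

Lemma esum_path_rcons n (F : seq S -> \bar R) : (forall s, (0 <= F s)%E) ->
  (\esum_(s in paths_of_length n.+1) F s =
   \esum_(s in paths_of_length n) \esum_(y in [set: S]) F (rcons s y))%E.
Proof.
move=> F0; rewrite esum_setX//.
apply: (@reindex_esum R _ _ _ _ (fun sy : seq S * S => rcons sy.1 sy.2)); split.
- by move=> [s y] [/= sn _]; rewrite /paths_of_length /= size_rcons sn.
- by move=> [s y] [s' y'] _ _ /= /rcons_inj[-> ->].
- move=> s; case/lastP: s => // s y; rewrite /paths_of_length /= size_rcons => -[sn].
  by exists (s, y).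
Qed.

Lemma esum_path_weight n x :
  (\esum_(s in paths_of_length n) (path_weight x s)%:E = 1)%E.
Proof.
elim: n x => [|n IH] x.
  have -> : paths_of_length 0 = [set [::]].
    by apply/seteqP; split => [s /= /size0nil|s ->].
  by rewrite esum_set1 //= lee_fin.
rewrite esum_path_cons => [|s]; last by rewrite lee_fin path_weight_ge0.
rewrite -(trans_sum1 M x); apply: eq_esum => y _ /=.
under eq_esum do rewrite EFinM.
rewrite esumZl ?trans_ge0// => [|s]; last by rewrite lee_fin path_weight_ge0.
by rewrite IH mule1.
Qed.

Lemma esum_path_weight_prefix n x s : (size s <= n)%N ->
  (\esum_(s' in paths_of_length n `&` [set s' | take (size s) s' = s])
     (path_weight x s')%:E = (path_weight x s)%:E)%E.
Proof.
move=> sn.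
rewrite [X in esum X](_ : _ = (cat s) @` paths_of_length (n - size s)).
  rewrite esum_image; last by move=> u v _ _ /eqP; rewrite eqseq_cat// eqxx => /eqP.
  under eq_esum do rewrite path_weight_cat EFinM.
  rewrite esumZl ?path_weight_ge0// => [|u]; last by rewrite lee_fin path_weight_ge0.
  by rewrite esum_path_weight mule1.
apply/seteqP; split => [u [un us]|_ [u un <-]]; last first.
  by split; rewrite /paths_of_length /= ?size_cat ?un ?subnKC// take_size_cat.
exists (drop (size s) u); first by rewrite /paths_of_length /= size_drop un.
by rewrite -{1}us cat_take_drop.
Qed.

Definition path_fun (k : nat) (x : S) (s : seq S) : 'I_k.+1 -> S :=
  fun j => nth x (x :: s) j.

Lemma path_fun_surj k (f : 'I_k.+1 -> S) :
  f = path_fun (f ord0) [seq f (lift ord0 i) | i <- enum 'I_k].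
Proof.
apply/funext => j; rewrite /path_fun; case: (unliftP ord0 j) => [i|] -> //=.
by rewrite (nth_map i) ?size_enum_ord add0n ?nth_ord_enum.
Qed.

(** Translates agreement up to time [i], the form of [past] in [trajectory], into equality of list
    prefixes. *)
Lemma path_fun_prefixP k (i : nat) x y s s' : (i <= k)%N ->
  size s = k -> size s' = k ->
  (forall j : 'I_k.+1, (j <= i)%N -> path_fun y s' j = path_fun x s j) <->
  y = x /\ take i s' = take i s.
Proof.
move=> ik sk s'k; split => [h|[-> h] j ji].
  have yx : y = x by exact: (h ord0).
  split=> //; apply: (@eq_from_nth _ x); first by rewrite !size_take sk s'k.
  move=> n; rewrite size_take_min s'k leq_min => /andP[ni nk].
  have nk1 : (n.+1 < k.+1)%N by rewrite ltnS (leq_trans ni).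
  by rewrite !nth_take//; have := h (Ordinal nk1) ni; rewrite /path_fun /= yx.
rewrite /path_fun; case: (nat_of_ord j) ji => //= n ni.
by rewrite -(nth_take _ ni) h nth_take.
Qed.

End path_weights.
Arguments paths_of_length {S} n.
Arguments path_fun {S k} x s.

(** * The law of a trajectory *)

Section laws.
Context {R : realType} {S : countType} (M : markov_chain R S).
Context d (T : measurableType d) (P : probability T R) (k : nat).
Variables (X : 'I_k.+1 -> T -> S) (nu : S -> R).
Hypothesis (X_trajectory : trajectory M P X).
Hypothesis (X_start : forall x, P [set t | X ord0 t = x] = (nu x)%:E).

(** Paths are finite functions into [S], hence countably many, so the event is a countable union of
    events that fix every coordinate. *)
Lemma path_measurable (A : set ('I_k.+1 -> S)) :
  measurable [set t | A (fun j => X j t)].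
Proof.
pose Y t := [ffun j => X j t].
have -> : [set t | A (fun j => X j t)] =
  \bigcup_(f in [set: {ffun 'I_k.+1 -> S}])
    ([set t | A f] `&` \bigcap_(j in [set: 'I_k.+1]) [set t | X j t = f j]).
  apply/seteqP; split => t /=.
    move=> At; exists (Y t) => //; split.
      by rewrite /=; have -> : (Y t : _ -> _) = X^~ t by apply/funext => j; rewrite ffunE.
    by move=> j _ /=; rewrite ffunE.
  by move=> [f _ [/= Af fX]]; have -> : X^~ t = f by apply/funext => j; exact: fX.
apply: countable_bigcupT_measurable; first exact: countableP.
move=> f; apply: measurableI.
  have [Af|nAf] := pselect (A f).
    by have -> : [set _ : T | A f] = setT by apply/seteqP; split.
  by have -> : [set _ : T | A f] = set0 by apply/seteqP; split.
apply: fin_bigcap_measurable; first exact: finite_finset.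
by move=> j _; apply: (X_trajectory.1 j [set f j]).
Qed.

(** The chain rule, by induction on [i]: each further time multiplies the probability by one
    conditional probability, which is a transition. *)
Lemma prefix_law x s i : size s = k -> (i <= k)%N ->
  P [set t | forall j : 'I_k.+1, (j <= i)%N -> X j t = path_fun x s j] =
  (nu x * path_weight M x (take i s))%:E.
Proof.
move=> sk; elim: i => [|i IH] ik.
  rewrite take0 /= mulr1 -X_start; congr (P _); apply/seteqP; split => t /=.
    by move=> /(_ ord0 erefl).
  by move=> xt j; rewrite leqn0 => /eqP j0; rewrite (_ : j = ord0)//; exact/val_inj.
have := X_trajectory.2 (path_fun x s) (Ordinal ik).
set past := [set t | _].
have {}IH : P past = (nu x * path_weight M x (take i s))%:E := IH (ltnW ik).
have -> : [set t | forall j : 'I_k.+1, (j <= i.+1)%N -> X j t = path_fun x s j] =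
    [set t | X (lift ord0 (Ordinal ik)) t = path_fun x s (lift ord0 (Ordinal ik))]
    `&` past.
  apply/seteqP; split => t /=.
    by move=> h; split => [|j ji]; apply: h => //; exact: (leq_trans ji).
  move=> [h1 h2] j; rewrite leq_eqVlt => /predU1P[ji|]; last exact: h2.
  by rewrite (_ : j = lift ord0 (Ordinal ik))//; exact/val_inj.
rewrite /cond_prob; set next := [set t | X (lift _ _) t = _].
have mpast : measurable past.
  exact: (path_measurable [set f | forall j : 'I_k.+1, (j <= i)%N -> f j = path_fun x s j]).
have mnext : measurable next.
  exact: (path_measurable [set f | f _ = _]).
rewrite (take_nth x) ?sk// path_weight_rcons mulrA.
(* On a null past [trajectory] prescribes no conditional probability, but then both sides vanish. *)
have [p0 _|p0] := eqVneq (P past) 0%E.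
  move: (IH); rewrite p0 => -[<-]; rewrite mul0r.
  exact: (subset_measure0 (measurableI _ _ mnext mpast) mpast (@subIsetr _ _ _) p0).
move=> /(_ isT) h.
have p0' : fine (P past) != 0%R by rewrite fine_eq0// fin_num_measure.
move/(canRL (mulfVK p0')): h.
have -> : path_fun x s (lift ord0 (Ordinal ik)) = nth x s i by [].
have -> : path_fun x s (widen_ord (leqnSn k) (Ordinal ik)) = last x (take i s).
  by rewrite last_take ?sk// ltnW.
by rewrite IH /= mulrC => <-; rewrite fineK// fin_num_measure//; exact: measurableI.
Qed.

Lemma trajectory_law (A : set ('I_k.+1 -> S)) :
  (P [set t | A (fun j => X j t)] =
  \esum_(u in [set u | size u.2 = k /\ A (path_fun u.1 u.2)])
    (nu u.1 * path_weight M u.1 u.2)%:E)%E.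
Proof.
pose code (f : 'I_k.+1 -> S) := (f ord0, [seq f (lift ord0 i) | i <- enum 'I_k]).
have codeK f : path_fun (code f).1 (code f).2 = f by rewrite -path_fun_surj.
have size_code f : size (code f).2 = k by rewrite size_map size_enum_ord.
have -> : [set t | A (fun j => X j t)] = (fun t => code (fun j => X j t)) @^-1`
    [set u | size u.2 = k /\ A (path_fun u.1 u.2)].
  apply/seteqP; split => t.
    move=> At; split; first exact: size_code.
    by rewrite -[X in A X]/(path_fun (code (X^~ t)).1 (code (X^~ t)).2) codeK.
  by case=> _; rewrite -[X in A X]/(path_fun (code (X^~ t)).1 (code (X^~ t)).2) codeK.
rewrite probability_preimage_esum; last first.
  by move=> B; exact: (path_measurable [set f | B (code f)]).
apply: eq_esum => -[x s] [/= sk As].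
rewrite -[in RHS](take_oversize (leqnn (size s))) sk -prefix_law//.
congr (P _); apply/seteqP; split => t /=.
  by move=> xs j _; rewrite -[X j t]/((fun j => X j t) j) -(codeK (fun j => X j t)) xs.
have [h _] := @path_fun_prefixP S k k x (X ord0 t) s
  [seq X (lift ord0 i) t | i <- enum 'I_k] (leqnn k) sk (size_code (X^~ t)).
move=> e; have [|xx] := h.
  by move=> j jk; rewrite -(e j jk); exact: (congr1 (@^~ j) (codeK (X^~ t))).
rewrite !take_oversize ?sk// ?(size_code (X^~ t))// => ts.
by rewrite /code xx ts.
Qed.

End laws.

Lemma trajectory_from_law {R : realType} {S : countType} (M : markov_chain R S)
    d (T : measurableType d) (P : probability T R) (k : nat)
    (X : 'I_k.+1 -> T -> S) (x : S) (A : set ('I_k.+1 -> S)) :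
  trajectory_from M P x X ->
  (P [set t | A (fun j => X j t)] =
  \esum_(s in paths_of_length k `&` [set s | A (path_fun x s)])
    (path_weight M x s)%:E)%E.
Proof.
move=> [XM X0].
have mX y : measurable [set t | X ord0 t = y] := XM.1 ord0 [set y].
(* The start is the point mass at [x]: any other start lies in the complement of an event of
   probability 1. *)
rewrite (trajectory_law XM (nu := fun y => (y == x)%:R)) => [|y]; last first.
  have [->//|yx] := eqVneq y x.
  have PC : P (~` [set t | X ord0 t = x]) = 0%E.
    by rewrite probability_setC// X0 subee.
  apply: (subset_measure0 (mX y) (measurableC (mX x)) _ PC) => t /= ->.
  by apply/eqP.
rewrite [LHS](esumID ([set x] `*` setT)) => [|u _]; last first.
  by rewrite lee_fin mulr_ge0// path_weight_ge0.
rewrite [X in (_ + X)%E]esum1 ?adde0 => [|u [_ /= h]]; last first.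
  by case: eqVneq => [e|]; [case: h|rewrite mul0r].
rewrite (_ : _ `&` _ = pair x @` (paths_of_length k `&` [set s | A (path_fun x s)])).
  rewrite esum_image => [|u v _ _ []//]; apply: eq_esum => s _ /=.
  by rewrite eqxx mul1r.
apply/seteqP; split => [[y s]/= [[sk As] [yx _]]|_ [s [/= sk As] <-]//].
by exists s; rewrite -?yx.
Qed.

(** * Existence of trajectories and detailed balance *)

(* The sample space is [nat] because it already carries the discrete
   sigma-algebra; [U] is embedded in it by [pickle]. *)
Lemma discrete_probability_exists {R : realType} (U : countType) (u0 : U)
    (q : U -> R) :
  (forall u, 0 <= q u) -> (\esum_(u in [set: U]) (q u)%:E = 1)%E ->
  exists (P : probability nat R) (Y : nat -> U), forall A : set U,
    (P (Y @^-1` A) = \esum_(u in A) (q u)%:E)%E.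
Proof.
move=> q0 q1.
pose P (B : set nat) : \bar R := (\esum_(u in [set u | B (pickle u)]) (q u)%:E)%E.
have P0 : P set0 = 0%E by rewrite /P esum_set0.
have P_ge0 B : (0 <= P B)%E by apply: esum_ge0 => u _; rewrite lee_fin.
have P_sigma : semi_sigma_additive P.
  move=> F mF tF mUF; apply: cvg_toP.
    apply: ereal_nondecreasing_is_cvgn => a b ab.
    by apply: lee_sum_nneg_natr => // n _ _; exact: P_ge0.
  rewrite /P -nneseries_sum_bigcup//.
    apply/trivIsetP => i j _ _ ij; apply/seteqP; split => // u [/= ui uj].
    by move/trivIsetP: tF => /(_ i j I I ij) /seteqP[h _]; exact: (h (pickle u)).
pose mP := isMeasure.Build _ _ _ P P0 P_ge0 P_sigma.
pose P' : {measure set nat -> \bar R} := HB.pack P mP.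
have P'1 : P' setT = 1%E by rewrite /= /P q1.
pose P'' : probability nat R := 
  HB.pack (Measure.sort P') (Measure_isProbability.Build _ _ _ (Measure.sort P') P'1).
(* The default [u0] is reached only off the range of [pickle], a set of mass zero. *)
exists P'', (fun n => odflt u0 (unpickle n)) => A.
by rewrite /= /P; congr esum; apply/seteqP; split => u /=; rewrite pickleK.
Qed.

(** [reversible] and [outlier_prob] quantify over all trajectories, so exploiting them requires an
    actual one. It is built on pairs of a start and a list of [k] further states, weighted by [nu]
    times the path weight. *)
Lemma trajectory_exists {R : realType} {S : countType} (M : markov_chain R S)
    (k : nat) (nu : S -> R) :
  (forall x, 0 <= nu x) -> (\esum_(x in [set: S]) (nu x)%:E = 1)%E ->
  exists (P : probability nat R) (X : 'I_k.+1 -> nat -> S),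
    trajectory M P X /\ forall x, P [set t | X ord0 t = x] = (nu x)%:E.
Proof.
move=> nu0 nu1.
have [x0] := esum_eq1_inhabited nu1.
have w0 x s : (0 <= (path_weight M x s)%:E)%E by rewrite lee_fin path_weight_ge0.
pose q (u : S * seq S) := nu u.1 * (path_weight M u.1 u.2 * (size u.2 == k)%:R).
have q0 u : 0 <= q u by rewrite !mulr_ge0 ?path_weight_ge0.
have q1 : (\esum_(u in [set: S * seq S]) (q u)%:E = 1)%E.
  rewrite -setXTT -(@esum_setX R _ _ setT setT (fun x s => (q (x, s))%:E)); last first.
    by move=> x s; rewrite lee_fin.
  rewrite -nu1; apply: eq_esum => x _; rewrite /q /=.
  under eq_esum do rewrite EFinM.
  rewrite esumZl// => [|s]; last by rewrite lee_fin mulr_ge0 ?path_weight_ge0.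
  rewrite -[RHS]mule1 -(esum_path_weight M k x); congr (_ * _)%E.
  rewrite -[in RHS](setTI (paths_of_length k)).
  rewrite (_ : paths_of_length k = [set s | size s == k]) ?esum_ind//.
  by apply/seteqP; split => s /= /eqP.
have [P [Y PY]] := discrete_probability_exists (x0, [::]) q0 q1.
pose X (j : 'I_k.+1) t := path_fun (Y t).1 (Y t).2 j.
have PX x s i : size s = k -> (i <= k)%N ->
    P [set t | forall j : 'I_k.+1, (j <= i)%N -> X j t = path_fun x s j] =
    (nu x * path_weight M x (take i s))%:E.
  move=> sk ik.
  rewrite (PY [set u | forall j : 'I_k.+1, (j <= i)%N ->
    path_fun u.1 u.2 j = path_fun x s j]).
  rewrite (esumID [set u | size u.2 = k]) => [|u _]; last by rewrite lee_fin.
  rewrite [X in (_ + X)%E]esum1 ?adde0 => [|u [_ /= /eqP/negbTE h]]; last first.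
    by rewrite /q h !mulr0.
  rewrite (_ : _ `&` _ = pair x @`
    (paths_of_length k `&` [set s' | take (size (take i s)) s' = take i s])).
    rewrite esum_image => [|u v _ _ []//].
    under eq_esum => s' [/= s'k _] do rewrite /q /= s'k eqxx mulr1 EFinM.
    rewrite esumZl// esum_path_weight_prefix//.
    by rewrite size_take_min sk (minn_idPl ik).
  rewrite size_take_min sk (minn_idPl ik).
  apply/seteqP; split => [[y s'] /= [h s'k]|_ [s' [/= s'k ts'] <-] /=].
    have [/(_ h)[-> ts'] _] := path_fun_prefixP x y ik sk s'k.
    by exists s'.
  split=> //; have [_] := path_fun_prefixP x x ik sk s'k; exact.
exists P, X; split; last first.
  move=> x; have sx : size (nseq k x) = k by rewrite size_nseq.
  have := PX x _ 0 sx (leq0n k); rewrite take0 mulr1 => <-.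
  congr (P _); apply/seteqP; split => t /=.
    by move=> xt j; rewrite leqn0 => /eqP j0; rewrite (_ : j = ord0)//; exact/val_inj.
  by move=> /(_ ord0 erefl).
split=> [j A //|f i].
rewrite (path_fun_surj f); set x := f ord0; set s := map _ _.
have sk : size s = k by rewrite size_map size_enum_ord.
move=> cur next past past0.
have {}PX_past : P past = (nu x * path_weight M x (take i s))%:E.
  exact: PX _ _ _ sk (ltnW (ltn_ord i)).
rewrite /cond_prob.
have -> : [set t | X next t = path_fun x s next] `&` past =
    [set t | forall j : 'I_k.+1, (j <= i.+1)%N -> X j t = path_fun x s j].
  apply/seteqP; split => t /=.
    move=> [h1 h2] j; rewrite leq_eqVlt => /predU1P[ji|]; last exact: h2.
    by rewrite (_ : j = next)//; exact/val_inj.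
  by move=> h; split => [|j ji]; apply: h => //; exact: (leq_trans ji).
move: past0; rewrite PX_past PX//= => past0.
rewrite (take_nth x) ?sk// path_weight_rcons mulrA mulrC mulrA mulVf ?mul1r//.
by rewrite last_take// sk ltnW.
Qed.

(** Reversal of the stationary one-step trajectory exchanges the event of going from [x] to [y] with
    that of going from [y] to [x]. *)
Lemma reversible_detailed_balance {R : realType} {S : countType}
    (M : markov_chain R S) (mu : S -> R) x y :
  stationary_distribution M mu -> reversible M mu ->
  mu x * M x y = mu y * M y x.
Proof.
move=> [mu0 mu1 _] revM.
have [P [X [XM X0]]] := trajectory_exists M 1 mu0 mu1.
have law x' y' : P [set t | X ord0 t = x' /\ X ord_max t = y'] = (mu x' * M x' y')%:E.
  rewrite -[M x' y']mulr1 -/(path_weight M x' [:: y']).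
  rewrite -(prefix_law XM X0 x' (erefl : size [:: y'] = 1) (leqnn 1)).
  congr (P _); apply/seteqP; split => t /= h.
    case: h => h0 h1 [[|[|]]// hj] _.
      by rewrite (_ : Ordinal hj = ord0)//; exact/val_inj.
    by rewrite (_ : Ordinal hj = ord_max)//; exact/val_inj.
  by split; apply: (h _ _).
have := revM _ _ P 1 X (conj XM X0) [set f | f ord0 = x /\ f ord_max = y].
rewrite law (_ : [set t | _] = [set t | X ord0 t = y /\ X ord_max t = x]).
  by rewrite law => -[].
have r0 : rev_ord (ord0 : 'I_2) = ord_max by exact/val_inj.
have r1 : rev_ord (ord_max : 'I_2) = ord0 by exact/val_inj.
by apply/seteqP; split => t /=; rewrite r0 r1 => -[].
Qed.

(** * Low ranks along a path *)

Section low_ranks.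
Context {R : realType} {S : countType} (M : markov_chain R S) (omega : S -> R).

(* The successor accounts for [x] itself in the path [x :: s]. *)
Definition low_rank (K : R) (x : S) (s : seq S) : bool :=
  (count (fun y => omega y <= omega x) s).+1%:R <= K.

(** [K] is an absolute count, not a fraction of [n], so that paths of different lengths can be
    compared at the same threshold. *)
Definition low_rank_prob (n : nat) (K : R) (x : S) : \bar R :=
  (\esum_(s in paths_of_length n `&` [set s | low_rank K x s])
    (path_weight M x s)%:E)%E.

Lemma eps_outlier_path_fun k eps x s : size s = k ->
  @eps_outlier R eps k (fun j => omega (path_fun x s j)) =
  low_rank (eps * k.+1%:R) x s.
Proof.
move=> sk; rewrite /eps_outlier /low_rank cardsE; congr (_%:R <= _).
rewrite -sum1_card.
transitivity (count (fun y => omega y <= omega x) (x :: s)).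
  rewrite -sum1_count (big_nth x) /= sk big_mkord.
  by apply: eq_bigl => j.
by rewrite /= lexx.
Qed.

Lemma low_rank_prob_ge0 n K x : (0 <= low_rank_prob n K x)%E.
Proof. by apply: esum_ge0 => s _; rewrite lee_fin path_weight_ge0. Qed.

Lemma low_rank_prob_le1 n K x : (low_rank_prob n K x <= 1)%E.
Proof.
rewrite -(esum_path_weight M n x); apply: subset_esum => //.
by move=> s; rewrite lee_fin path_weight_ge0.
Qed.

Lemma low_rank_prob_fin_num n K x : low_rank_prob n K x \is a fin_num.
Proof.
rewrite ge0_fin_numE ?low_rank_prob_ge0//.
by rewrite (le_lt_trans (low_rank_prob_le1 n K x))// ltry.
Qed.

(** Every trajectory from [x] gives the event this probability, so the set inside [xget] contains
    it; the existence of one such trajectory excludes any other value. *)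
Lemma outlier_probE k eps x :
  (outlier_prob M omega k eps x)%:E = low_rank_prob k (eps * k.+1%:R) x.
Proof.
have law d (T : measurableType d) (P : probability T R) (X : 'I_k.+1 -> T -> S) :
    trajectory_from M P x X ->
    P [set t | eps_outlier eps (fun j => omega (X j t))] =
    low_rank_prob k (eps * k.+1%:R) x.
  move=> XM.
  rewrite (trajectory_from_law [set f | eps_outlier eps (fun j => omega (f j))] XM).
  congr esum; apply/seteqP; split => s [sk] /=;
  by rewrite eps_outlier_path_fun.
have nu1 : (\esum_(y in [set: S]) ((y == x)%:R : R)%:E = 1)%E.
  rewrite (esumID [set x])// setTI esum_set1 ?eqxx// esum1 ?adde0// => y [_ /=].
  by case: eqVneq.
have [P [X [XM X0]]] := trajectory_exists M k (fun y => ler0n R (y == x)) nu1.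
have {}X0 : trajectory_from M P x X by split; rewrite // X0 eqxx.
rewrite /outlier_prob; case: xgetP => [p _ /(_ _ _ P X X0)|
  /(_ (fine (low_rank_prob k (eps * k.+1%:R) x))) []].
  by rewrite (law _ _ P X X0).
by move=> d T Q Y YM; rewrite (law _ _ Q Y YM) fineK// low_rank_prob_fin_num.
Qed.

(** Deleting the last state cannot raise the count, and the weights of the one-step extensions of a
    path sum to the weight of that path. *)
Lemma low_rank_prob_antitone m n K x : (m <= n)%N ->
  (low_rank_prob n K x <= low_rank_prob m K x)%E.
Proof.
have w0 s : (0 <= (path_weight M x s)%:E)%E by rewrite lee_fin path_weight_ge0.
move=> /subnK <-; elim: (n - m)%N => // {}n; rewrite addSn; apply: le_trans.
move: (n + m)%N => {}n; rewrite /low_rank_prob !esum_ind esum_path_rcons; last first.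
  by move=> s; rewrite lee_fin mulr_ge0 ?path_weight_ge0.
apply: le_esum => s _.
apply: (@le_trans _ _ (\esum_(y in [set: S])
    ((path_weight M x s * (low_rank K x s)%:R)%:E * (M (last x s) y)%:E))%E).
  apply: le_esum => y _; rewrite path_weight_rcons -!EFinM lee_fin.
  rewrite mulrAC ler_wpM2r ?trans_ge0// ler_wpM2l ?path_weight_ge0// ler_nat.
  case: (boolP (low_rank K x (rcons s y))) => // low_sy; rewrite lt0b.
  by apply: le_trans low_sy; rewrite ler_nat ltnS -cats1 count_cat leq_addr.
rewrite esumZl ?trans_sum1 ?mule1// ?mulr_ge0 ?path_weight_ge0// => y.
by rewrite lee_fin trans_ge0.
Qed.

(** Among the indices that satisfy the condition take one with the largest label: its count includes
    all the others and is at most [K]. *)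
Lemma sum_low_index (x0 : S) (s : seq S) (K : R) : 0 <= K ->
  \sum_(i < size s)
    ((count (fun y => omega y <= omega (nth x0 s i))%R s)%:R <= K)%R%:R <= K.
Proof.
move=> K0.
pose low (i : 'I_(size s)) :=
  (count (fun y => omega y <= omega (nth x0 s i)) s)%:R <= K.
rewrite -[X in X <= _]/(\sum_(i < size s) (low i)%:R) -natr_sum -big_mkcond sum1_card.
have [i0 low_i0|nolow] := pickP low; last by rewrite eq_card0.
case: (@Order.TotalTheory.arg_maxP _ _ _ i0 low (fun i => omega (nth x0 s i)) low_i0).
move=> i low_i max_i; apply: le_trans low_i.
rewrite ler_nat -sum1_count (big_nth x0) big_mkord sum1_card.
by apply: subset_leq_card; apply/fintype.subsetP => j lowj; exact: max_i.
Qed.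

End low_ranks.

(** * Second moment of the outlier probability *)

Section second_moment.
Context {R : realType} {S : countType} (M : markov_chain R S) (omega : S -> R).
Variable (mu : S -> R).
Hypotheses (mu_stationary : stationary_distribution M mu)
           (M_reversible : reversible M mu).

Let mu_ge0 x : 0 <= mu x. Proof. by case: mu_stationary. Qed.

Definition stationary_weight (t : seq S) : R :=
  if t is x :: s then mu x * path_weight M x s else 0.

Lemma stationary_weight_ge0 t : 0 <= stationary_weight t.
Proof. by case: t => //= x s; rewrite mulr_ge0 ?mu_ge0 ?path_weight_ge0. Qed.

(** Moving a state [y] of [l] in front of [x] replaces the factor [mu x * M x y] by [mu y * M y x];
    detailed balance makes these equal, so turning the first half around keeps its weight. *)
Lemma stationary_weight_catrev l x s : stationary_weight (catrev l (x :: s)) =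
  mu x * path_weight M x l * path_weight M x s.
Proof.
elim: l x s => [|y l IH] x s /=; first by rewrite mulr1.
rewrite IH /= mulrACA -(reversible_detailed_balance _ _ mu_stationary M_reversible).
by rewrite -!mulrA; congr (_ * (_ * _)); rewrite mulrC.
Qed.

Lemma esum_stationary_weight n :
  (\esum_(t in paths_of_length n.+1) (stationary_weight t)%:E = 1)%E.
Proof.
rewrite esum_path_cons => [|t]; last by rewrite lee_fin stationary_weight_ge0.
have [_ <- _] := mu_stationary; apply: eq_esum => x _ /=.
under eq_esum do rewrite EFinM.
rewrite esumZl// => [|s]; last by rewrite lee_fin path_weight_ge0.
by rewrite esum_path_weight mule1.
Qed.

Definition low_index (x0 : S) (K : R) (t : seq S) (i : nat) : bool :=
  (count (fun y => omega y <= omega (nth x0 t i)) t)%:R <= K.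

(** The left side is a sum over triples [(x, l, r)]; gluing them to [rev l ++ x :: r] is injective,
    keeps the weight and puts [x] at index [i]. *)
Lemma two_sided_low_rank (x0 : S) (K : R) k i : (i <= k)%N ->
  (\esum_(x in [set: S])
     ((mu x)%:E * (low_rank_prob M omega i K x * low_rank_prob M omega (k - i) K x)) <=
   \esum_(t in paths_of_length k.+1)
     (stationary_weight t * (low_index x0 (2 * K) t i)%:R)%:E)%E.
Proof.
move=> ik.
pose g (x : S) (l r : seq S) : R :=
  mu x * path_weight M x l * path_weight M x r *
  ((low_rank omega K x l)%:R * (low_rank omega K x r)%:R).
have g0 x l r : (0 <= (g x l r)%:E)%E by rewrite lee_fin !mulr_ge0 ?path_weight_ge0.
have w0 x l (b : bool) : (0 <= (path_weight M x l * b%:R)%:E)%E.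
  by rewrite lee_fin mulr_ge0 ?path_weight_ge0.
pose D : set (S * (seq S * seq S)) :=
  setT `*` (paths_of_length i `*` paths_of_length (k - i)).
have -> : (\esum_(x in [set: S]) ((mu x)%:E *
    (low_rank_prob M omega i K x * low_rank_prob M omega (k - i) K x)) =
    \esum_(z in D) (g z.1 z.2.1 z.2.2)%:E)%E.
  rewrite /D -(esum_setX (T1 := S) (T2 := (seq S * seq S)%type) _ _
    (a := fun x z => (g x z.1 z.2)%:E))//.
  apply: eq_esum => x _.
  rewrite -(esum_setX _ _ (a := fun l r => (g x l r)%:E))//.
  transitivity (\esum_(l in paths_of_length i) \esum_(r in paths_of_length (k - i))
    ((mu x * (path_weight M x l * (low_rank omega K x l)%:R)) *
     (path_weight M x r * (low_rank omega K x r)%:R))%:E)%E; last first.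
    apply: eq_esum => l _; apply: eq_esum => r _; congr EFin.
    by rewrite /g -!mulrA; do 2 congr (_ * _); rewrite mulrCA.
  have := low_rank_prob_fin_num M omega (k - i) K x.
  rewrite /low_rank_prob !esum_ind => fin.
  rewrite esumM//; last first.
  - by move=> r; rewrite -lee_fin.
  - by move=> l; rewrite mulr_ge0// -lee_fin.
  by rewrite muleA; congr (_ * _)%E; rewrite -esumZl.
apply: (@le_trans _ _ (\esum_(z in D)
  (stationary_weight (catrev z.2.1 (z.1 :: z.2.2)) *
   (low_index x0 (2 * K) (catrev z.2.1 (z.1 :: z.2.2)) i)%:R)%:E)%E).
  apply: le_esum => -[x [l r]] [_ [/= li rk]]; rewrite lee_fin stationary_weight_catrev.
  rewrite /g ler_wpM2l ?mulr_ge0 ?path_weight_ge0// -natrM mulnb ler_nat.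
  case: andP => //= -[ll lr]; rewrite lt0b /low_index catrevE.
  rewrite nth_cat size_rev li ltnn subnn /= count_cat count_rev /= lexx.
  (* Each half counts [x] itself but the glued path does so only once, so the sum of the two bounds
     leaves one to spare. *)
  have := lerD ll lr; rewrite -mulr2n -[K *+ 2]mulr_natl; apply: le_trans.
  by rewrite -natrD ler_nat addSn; lia.
rewrite -(@esum_image R _ _ D (fun z => catrev z.2.1 (z.1 :: z.2.2))
  (fun t => (stationary_weight t * (low_index x0 (2 * K) t i)%:R)%:E)).
  apply: subset_esum; last by move=> t; rewrite lee_fin mulr_ge0 ?stationary_weight_ge0.
  move=> _ [[x [l r]] [_ [/= li rk]] <-]; rewrite /paths_of_length /=.
  by rewrite catrevE size_cat size_rev li /= rk addnS subnKC.
(* Since [l] has length [i], cutting the glued path at [i] recovers the triple. *)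
move=> [x [l r]] [x' [l' r']] /set_mem[_ [/= li rk]] /set_mem[_ [/= li' rk']].
rewrite !catrevE => /eqP; rewrite eqseq_cat ?size_rev ?li ?li'// => /andP[/eqP].
by move=> /(can_inj revK) -> /eqP[-> ->].
Qed.

Lemma second_moment_outlier_prob k eps : 0 < eps ->
  (\esum_(x in [set: S]) (mu x * outlier_prob M omega k eps x ^+ 2)%:E
   <= (2 * eps)%:E)%E.
Proof.
move=> eps0; set K := eps * k.+1%:R.
have K0 : 0 <= 2 * K by rewrite !mulr_ge0// ltW.
set E := esum _ _.
have [x0] : inhabited S by case: mu_stationary => _ /esum_eq1_inhabited.
have E_le (i : 'I_k.+1) : (E <= \esum_(t in paths_of_length k.+1)
     (stationary_weight t * (low_index x0 (2 * K) t i)%:R)%:E)%E.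
  have ik : (i <= k)%N by rewrite -ltnS.
  apply: le_trans (two_sided_low_rank x0 K ik); apply: le_esum => x _.
  rewrite EFinM lee_wpmul2l ?lee_fin// expr2 EFinM outlier_probE.
  (* Both halves have at most [k] steps, so each factor is at least the outlier probability for [k]
     steps. *)
  by rewrite lee_pmul ?low_rank_prob_ge0 ?low_rank_prob_antitone ?leq_subr.
have : (\sum_(i < k.+1) E <= (2 * K)%:E)%E.
  apply: (le_trans (lee_sum _ (fun i _ => E_le i))).
  (* Exchanging the sums leaves, for each path, the number of its low indices, at most [2 * K]
     whatever the path; the weights have total 1. *)
  rewrite -esum_sum => [|t i _ _]; last first.
    by rewrite lee_fin mulr_ge0 ?stationary_weight_ge0.
  rewrite -[leRHS]mule1 -(esum_stationary_weight k) -esumZl//; last first.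
    by move=> t; rewrite lee_fin stationary_weight_ge0.
  apply: le_esum => t tk; rewrite sumEFin -mulr_sumr -EFinM lee_fin mulrC.
  rewrite ler_wpM2r ?stationary_weight_ge0// -tk; exact: sum_low_index.
(* Finiteness of [E] permits cancelling the factor [k.+1] shared with [K]. *)
have Efin : E \is a fin_num.
  rewrite ge0_fin_numE; last first.
    by apply: esum_ge0 => x _; rewrite lee_fin mulr_ge0 ?sqr_ge0.
  apply: (le_lt_trans (E_le ord0)); rewrite (@le_lt_trans _ _ 1%E) ?ltry//.
  rewrite -(esum_stationary_weight k); apply: le_esum => t _; rewrite lee_fin.
  by rewrite -[leRHS]mulr1 ler_wpM2l ?stationary_weight_ge0// lern1 leq_b1.
rewrite -(fineK Efin) sumEFin sumr_const card_ord !lee_fin /K mulrA.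
by rewrite -[_ *+ _]mulr_natr ler_pM2r ?ltr0n.
Qed.

Lemma outlier_prob_le k eps alpha x0 : 0 < eps -> 0 < alpha ->
  ~ eps_alpha_outlier M mu omega k eps alpha x0 ->
  outlier_prob M omega k eps x0 <= Num.sqrt (2 * eps / alpha).
Proof.
move=> eps0 alpha0; rewrite /eps_alpha_outlier => /negP; rewrite -ltNge.
set p := outlier_prob M omega k eps.
have p0 x : 0 <= p x by rewrite -lee_fin outlier_probE low_rank_prob_ge0.
move=> alpha_lt.
(* Squared, the claim reads [p x0 ^+ 2 * alpha <= 2 * eps]; Markov's inequality gives it on the
   states with [p x0 <= p x], whose mass exceeds [alpha]. *)
rewrite -[leLHS]ger0_norm// -sqrtr_sqr ler_wsqrtr// ler_pdivlMr//.
rewrite -lee_fin; apply: le_trans (second_moment_outlier_prob k eps0).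
rewrite EFinM (@le_trans _ _ ((p x0 ^+ 2)%:E *
    \esum_(x in [set x | (p x0 <= p x)%R]) (mu x)%:E)%E)//.
  by rewrite lee_wpmul2l ?lee_fin ?sqr_ge0// ltW.
rewrite -esumZl ?sqr_ge0//.
apply: (@le_trans _ _ (\esum_(x in [set x | (p x0 <= p x)%R]) (mu x * p x ^+ 2)%:E)%E).
  apply: le_esum => x /= px; rewrite -EFinM lee_fin mulrC ler_wpM2l//.
  by rewrite ler_pXn2r ?nnegrE.
by apply: subset_esum => // x; rewrite lee_fin mulr_ge0 ?sqr_ge0.
Qed.

End second_moment.

(** * A Chernoff bound *)

Section chernoff.
Context {R : realType}.

(** The quotient of the quadratic by [expR] is 1 at 0, and its derivative has the sign of
    [1 / 2 * x - 3 / 4 * x ^+ 2], nonnegative exactly between 0 and [2 / 3]. *)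
Lemma expR_le_quadratic (t : R) : 0 <= t <= 2 / 3 ->
  expR t <= 1 + t + 3 / 4 * t ^+ 2.
Proof.
move=> /andP[t0 t23].
pose f (x : R) : R := (1 + x + 3 / 4 * x ^+ 2) * expR (- x).
have df (x : R) : is_derive x 1 f ((1 / 2 * x - 3 / 4 * x ^+ 2) * expR (- x)).
  rewrite /f; apply: is_derive_eq.
  by rewrite /GRing.scale /=; field.
have : f 0 <= f t.
  apply: (@ger0_derive1_ndecr R f 0 (2 / 3)) => //.
  - move=> x; rewrite in_itv /= => /andP[x0 x23]; rewrite derive1E derive_val.
    rewrite mulr_ge0 ?expR_ge0//; nra.
  - by apply: derivable_within_continuous.
rewrite /f oppr0 expR0 expr0n /= mulr0 !addr0 mulr1 expRN.
by rewrite ler_pdivlMr ?expR_gt0// mul1r.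
Qed.

(* The exponent is at most [mean * (3/4 * t^2 - t * (r / mean))]; the choice
   [t = 2/3 * min(r / mean, 1)] is dictated by the double root [2/3] of
   [3/4 * a^2 - a + 1/3]. *)
Lemma chernoff_exponent (mean r : R) : 0 < mean ->
  exists2 t : R, 0 <= t &
  mean * (expR t - 1) - t * (mean + r) <= - Num.min (r ^+ 2 / (3 * mean)) (r / 3).
Proof.
move=> mean0.
have quad t : 0 <= t <= 2 / 3 ->
    mean * (expR t - 1) - t * (mean + r) <= 3 / 4 * mean * t ^+ 2 - t * r.
  move=> /expR_le_quadratic h; nra.
have [r0|r0] := lerP r 0.
  exists 0 => //; rewrite expR0 subrr mulr0 mul0r subr0 oppr_ge0.
  by rewrite ge_min [r / 3 <= 0]ler_pdivrMr// mul0r r0 orbT.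
have [rm|mr] := lerP r mean.
  have t0 : 0 <= 2 / 3 * (r / mean) by rewrite !mulr_ge0// ?invr_ge0 ltW.
  exists (2 / 3 * (r / mean)) => //; apply: le_trans (quad _ _) _.
    by rewrite t0 /= ler_piMr// ler_pdivrMr// mul1r.
  rewrite lerNr ge_min; apply/orP; left; rewrite le_eqVlt; apply/orP; left.
  by apply/eqP; field; rewrite gt_eqF.
(* At [t = 2 / 3] the quadratic bound is [mean / 3 - 2 / 3 * r], and [mean < r] here. *)
exists (2 / 3) => //; apply: le_trans (quad _ _) _; first by rewrite lexx andbT.
rewrite lerNr ge_min; apply/orP; right; lra.
Qed.

(** Independence gives the exact law of the random set [Y] of successes, so the exponential Markov
    inequality reduces to finite sums over subsets of ['I_m]. *)
Lemma chernoff_tail d (T : measurableType d) (P : probability T R) (m : nat)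
    (b : 'I_m -> T -> bool) (p q a t : R) :
  (forall i, measurable [set x | b i x]) ->
  (forall I : {set 'I_m}, (P [set x | forall i, b i x = (i \in I)] =
    \prod_(i < m) P [set x | b i x = (i \in I)])%E) ->
  (forall i, P [set x | b i x] = p%:E) ->
  p <= q -> 0 <= t ->
  (P [set x | (a <= #|[set i | b i x]%SET|%:R)%R] <=
   (expR (m%:R * q * (expR t - 1) - t * a))%:E)%E.
Proof.
move=> mb indep bp pq t0.
have mbI i c : measurable [set x | b i x = c].
  case: c; first exact: mb.
  rewrite (_ : [set x | _] = ~` [set x | b i x]); last first.
    by apply/seteqP; split => x /=; case: (b i x).
  exact: measurableC.
pose Y x : {set 'I_m} := [set i | b i x]%SET.
have YE I : [set x | Y x = I] = [set x | forall i, b i x = (i \in I)].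
  apply/seteqP; split => x /=; first by move=> <- j; rewrite inE.
  by move=> h; apply/setP => j; rewrite inE h.
have mYI I : measurable [set x | Y x = I].
  rewrite YE (_ : [set x | _] = \bigcap_(i in [set: 'I_m]) [set x | b i x = (i \in I)]).
    by apply: fin_bigcap_measurable; [exact: finite_finset|move=> j _; exact: mbI].
  by apply/seteqP; split => x /= h; [move=> i _|move=> i]; exact: h.
have mY : Defs.discrete_random_variable Y.
  move=> A; rewrite (_ : Y @^-1` A = \bigcup_(I in A) [set x | Y x = I]).
    by apply: fin_bigcup_measurable; [exact: finite_finset|move=> I _; exact: mYI].
  by apply/seteqP; split => x /=; [exists (Y x)|move=> [I AI /= ->]].
(* For [m = 0] there is no event to show that [p] is a probability. *)
have p01 : 0 <= p <= 1 \/ m = 0%N.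
  case: (m) b mb bp {indep mbI Y YE mYI mY} => [|m'] b mb bp; first by right.
  left; rewrite -!lee_fin -(bp ord0) measure_ge0 /=.
  exact: probability_le1.
pose w (I : {set 'I_m}) : R := \prod_(i < m) (if i \in I then p else 1 - p).
have PY I : P [set x | Y x = I] = (w I)%:E.
  rewrite YE indep /w -prodEFin; apply: eq_bigr => i _; case: ifP => _; first exact: bp.
  rewrite (_ : [set x | _] = ~` [set x | b i x]); last first.
    by apply/seteqP; split => x /=; case: (b i x).
  by rewrite probability_setC// EFinB bp.
have w0 I : 0 <= w I by rewrite -lee_fin -PY.
rewrite (_ : [set x | _] = Y @^-1` [set I : {set 'I_m} | (a <= #|I|%:R)%R])//.
rewrite (probability_preimage_esum _ _ mY) esum_finType => [|I]; last exact: measure_ge0.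
under eq_bigr do rewrite PY.
rewrite sumEFin lee_fin.
have -> : m%:R * q * (expR t - 1) - t * a = - (t * a) + m%:R * (q * (expR t - 1)).
  by rewrite -mulrA addrC.
rewrite expRD expRM_natl.
(* Markov's inequality term by term: when [a <= #|I|], the factor [expR (t * #|I| - t * a)] is at
   least 1. *)
apply: (@le_trans _ _ (expR (- (t * a)) * \sum_(I : {set 'I_m}) expR (t * #|I|%:R) * w I)).
  rewrite big_mkcond mulr_sumr; apply: ler_sum => I _; case: ifP => [aI|_].
    rewrite mulrA -expRD ler_peMl// -[leLHS]expR0 ler_expR addrC subr_ge0.
    by rewrite ler_wpM2l.
  by rewrite !mulr_ge0 ?expR_ge0.
rewrite ler_wpM2l ?expR_ge0//.
(* Binomial expansion over subsets: each success contributes [expR t * p], each failure [1 - p]. *)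
have -> : \sum_(I : {set 'I_m}) expR (t * #|I|%:R) * w I =
    (expR t * p + (1 - p)) ^+ m.
  rewrite -[in RHS](card_ord m) -prodr_const bigA_distr; apply: eq_bigr => I _.
  rewrite mulrC expRM_natr -prodr_const big_mkcond -big_split /=.
  by apply: eq_bigr => i _; case: ifP; rewrite mulrC ?mul1r.
have [/andP[p0 p1]|->] := p01; last by rewrite !expr0.
apply: lerXn2r; rewrite ?nnegrE ?expR_ge0//.
  by rewrite addr_ge0 ?mulr_ge0 ?expR_ge0 ?subr_ge0.
(* By [1 + x <= expR x] it remains to compare [p * (expR t - 1)] with [q * (expR t - 1)]. *)
apply: (le_trans _ (expR_ge1Dx _)).
have : 0 <= expR t - 1 by rewrite subr_ge0 -[leLHS]expR0 ler_expR.
nra.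
Qed.

End chernoff.

(** * The moment bound combined with the Chernoff bound *)

Theorem theorem2p4 (R : realType) (S : countType) (M : markov_chain R S)
    (mu : S -> R) (omega : S -> R)
    (mu_stationary : stationary_distribution M mu)
    (M_reversible : reversible M mu)
    (k m : nat) (m_ge1 : (1 <= m)%N)
    (eps alpha r : R) (eps_gt0 : 0 < eps) (alpha_gt0 : 0 < alpha)
    (sigma0 : S)
    (d : measure_display) (T : measurableType d) (P : probability T R)
    (X : 'I_m -> 'I_k.+1 -> T -> S)
    (X_trajectory : forall i : 'I_m, trajectory_from M P sigma0 (X i))
    (X_independent : independent_paths P X)
    (sigma0_not_outlier : ~ eps_alpha_outlier M mu omega k eps alpha sigma0) :
  let rho (t : T) : nat :=
    #|[set i : 'I_m | eps_outlier eps (fun j => omega (X i j t))]%SET| in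
  (P [set t | (m%:R * Num.sqrt (2 * eps / alpha) + r <= (rho t)%:R)%R] <=
   (expR (- Num.min (r ^+ 2 * Num.sqrt (alpha / (2 * eps)) / (3 * m%:R))
                    (r / 3)))%:E)%E.
Proof.
cbv zeta; set q := Num.sqrt (2 * eps / alpha).
have q0 : 0 < q by rewrite sqrtr_gt0 divr_gt0// mulr_gt0.
(* The two square roots are inverse to each other, which brings the exponent to the form in
   [chernoff_exponent] with mean [m%:R * q]. *)
have -> : Num.sqrt (alpha / (2 * eps)) = q^-1.
  by rewrite -[alpha / _]invf_div sqrtrV// ltW// divr_gt0// mulr_gt0.
have m0 : 0 < m%:R :> R by rewrite ltr0n.
have -> : r ^+ 2 * q^-1 / (3 * m%:R) = r ^+ 2 / (3 * (m%:R * q)).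
  by field; rewrite !gt_eqF.
have [t t0 /(le_trans _)tr] := chernoff_exponent r (mulr_gt0 m0 q0).
pose outlier (f : 'I_k.+1 -> S) := eps_outlier eps (fun j => omega (f j)).
have pq := outlier_prob_le mu_stationary M_reversible eps_gt0 alpha_gt0 sigma0_not_outlier.
apply: (le_trans (chernoff_tail (b := fun i x => outlier (fun j => X i j x))
  (m%:R * q + r) _ _ _ pq t0)).
- by move=> i; exact: (path_measurable (X_trajectory i).1 [set f | outlier f]).
- by move=> I; exact: (X_independent (fun i => [set f | outlier f = (i \in I)])).
- move=> i; rewrite outlier_probE.
  rewrite (trajectory_from_law [set f | outlier f] (X_trajectory i)).
  congr esum; apply/seteqP; split => s [sk] /=;
  by rewrite /outlier eps_outlier_path_fun.
by rewrite lee_fin ler_expR tr.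
Qed.
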